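(* Let $A\in\mathbb{R}^{d\times n}$ have columns $a_i=y_i\bar a_i$, where $\bar a_1,\dots,\bar a_n\in\mathbb{R}^d$ are data points and $y_i\in\{\pm1\}$ are labels. Let $\triangle=\{x\in\mathbb{R}^n: x_i\ge0,\ \sum_i x_i=1\}$ and let $x^\star$ be an optimal solution of the (dual) squared hinge loss SVM problem $$\min_{x\in\triangle}\ \tfrac12 x^\top A^\top A x .$$ Then for every $x\in\triangle$ and every $i\in\{1,\dots,n\}$, $$(a_i-Ax)^\top Ax>\sqrt{\max_{1\le j\le n}(Ax-a_j)^\top Ax}\ \,\|a_i-Ax\|_2\ \Longrightarrow\ x_i^\star=0 .$$
   Context: All norms are Euclidean. Here $x\in\triangle$ is any feasible (current) iterate. *)

(* Defs.v *)
(* The real numbers are an arbitrary [R : realType], and points of R^m are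
   column vectors. *)
From mathcomp Require Import all_boot all_order all_algebra.
From mathcomp Require Import reals.
Set Implicit Arguments.
Unset Strict Implicit.
Unset Printing Implicit Defensive.
Import Order.TTheory GRing.Theory Num.Theory.
Local Open Scope ring_scope.

Definition dot (R : realType) (m : nat) (u v : 'cV[R]_m) : R :=
  (u^T *m v) 0 0.

(* The Euclidean norm; the norm that MathComp-Analysis puts on matrices is the
   sup norm. *)
Definition norm2 (R : realType) (m : nat) (u : 'cV[R]_m) : R :=
  Num.sqrt (\sum_(k < m) u k 0 ^+ 2).

Definition simplex (R : realType) (n : nat) (x : 'cV[R]_n) : Prop :=
  (forall j, 0 <= x j 0) /\ \sum_(j < n) x j 0 = 1.

Definition svm_objective (R : realType) (d n : nat) (A : 'M[R]_(d, n))
    (x : 'cV[R]_n) : R :=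
  2^-1 * (x^T *m A^T *m A *m x) 0 0.

Definition svm_optimal (R : realType) (d n : nat) (A : 'M[R]_(d, n))
    (x : 'cV[R]_n) : Prop :=
  simplex x /\
  forall z : 'cV[R]_n, simplex z -> svm_objective A x <= svm_objective A z.

(* The maximum of [f] over the index set, nonempty because it contains [i0].
   The value does not depend on [i0]: the default [f i0] of the iterated
   maximum is itself one of the values of [f]. *)
Definition max_over (R : realType) (n : nat) (i0 : 'I_n) (f : 'I_n -> R) : R :=
  \big[Num.max/f i0]_(j < n) f j.

(* Main.v *)
(* Write w = Ax, w' = Ax' for an optimal x', s = w'.(w - w'), and let G be the
   maximum in the statement. Optimality gives the variational inequality
   w'.(Az - w') >= 0 on the simplex, so s >= 0; averaging (w - a_j).w <= G
   with the weights x'_j gives w.(w - w') <= G. Subtracting,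
   |w - w'|^2 <= G - s <= G. By Cauchy-Schwarz the screening condition then
   forces (a_i - w).w' > 0, hence (a_i - w').w' > s >= 0. As the numbers
   x'_j ((a_j - w').w') are nonnegative and sum to zero, x'_i = 0. *)
Require Import Defs.
From mathcomp Require Import all_boot all_order all_algebra.
From mathcomp Require Import reals.
From mathcomp Require Import ring lra.
Set Implicit Arguments.
Unset Strict Implicit.
Unset Printing Implicit Defensive.
Import Order.TTheory GRing.Theory Num.Theory.
Local Open Scope ring_scope.

Section Dot.
Variables (R : realType) (m : nat).
Implicit Types (u v w : 'cV[R]_m) (c : R).

Lemma dotE u v : dot u v = \sum_(k < m) u k 0 * v k 0.
Proof. by rewrite /dot mxE; apply: eq_bigr => k _; rewrite mxE. Qed.

Lemma dotC u v : dot u v = dot v u.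
Proof. by rewrite !dotE; apply: eq_bigr => k _; rewrite mulrC. Qed.

Lemma dotDl u v w : dot (u + v) w = dot u w + dot v w.
Proof. by rewrite /dot raddfD mulmxDl mxE. Qed.

Lemma dotDr u v w : dot u (v + w) = dot u v + dot u w.
Proof. by rewrite dotC dotDl !(dotC u). Qed.

Lemma dotZl c u v : dot (c *: u) v = c * dot u v.
Proof. by rewrite /dot linearZ -scalemxAl mxE. Qed.

Lemma dotZr c u v : dot u (c *: v) = c * dot u v.
Proof. by rewrite dotC dotZl dotC. Qed.

Lemma dotNl u v : dot (- u) v = - dot u v.
Proof. by rewrite -scaleN1r dotZl mulN1r. Qed.

Lemma dotNr u v : dot u (- v) = - dot u v.
Proof. by rewrite dotC dotNl dotC. Qed.

Lemma dotBl u v w : dot (u - v) w = dot u w - dot v w.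
Proof. by rewrite dotDl dotNl. Qed.

Lemma dotBr u v w : dot u (v - w) = dot u v - dot u w.
Proof. by rewrite dotDr dotNr. Qed.

Lemma dot_ge0 u : 0 <= dot u u.
Proof. by rewrite dotE sumr_ge0 // => k _; rewrite -expr2 sqr_ge0. Qed.

Lemma dot_eq0 u : dot u u = 0 -> u = 0.
Proof.
rewrite dotE => /eqP; rewrite psumr_eq0; last first.
  by move=> k _; rewrite -expr2 sqr_ge0.
move=> /allP u0; apply/colP => k; rewrite mxE.
by have := u0 k (mem_index_enum k); rewrite /= mulf_eq0 orbb => /eqP.
Qed.

Lemma norm2E u : norm2 u = Num.sqrt (dot u u).
Proof. by rewrite /norm2 dotE; under eq_bigr do rewrite expr2. Qed.

(** The squared length of [dot v v *: u - dot u v *: v] equals [dot v v] times the difference of the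
    two squared sides; for nonzero [v] the positive factor cancels. *)
Lemma CauchySchwarz_dot u v : dot u v <= norm2 u * norm2 v.
Proof.
rewrite !norm2E -sqrtrM ?dot_ge0 //.
apply: le_trans (ler_norm _) _; rewrite -sqrtr_sqr ler_wsqrtr //.
have [v0|v_neq0] := eqVneq (dot v v) 0.
  by rewrite (dot_eq0 v0) -(scale0r u) !dotZr !mul0r expr0n mulr0.
have v_gt0 : 0 < dot v v by rewrite lt0r v_neq0 dot_ge0.
have := dot_ge0 (dot v v *: u - dot u v *: v).
rewrite !(dotBl, dotBr, dotZl, dotZr) (dotC v u) => h.
rewrite -subr_ge0 -(pmulr_rge0 _ v_gt0).
by apply: le_trans h _; rewrite le_eqVlt; apply/orP; left; apply/eqP; ring.
Qed.

End Dot.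

Section Simplex.
Variables (R : realType) (d n : nat).
Implicit Types (A : 'M[R]_(d, n)) (x z : 'cV[R]_n) (u v : 'cV[R]_d).

Lemma dot_mulmxl A x v : dot (A *m x) v = \sum_(j < n) x j 0 * dot (col j A) v.
Proof.
rewrite dotE; under eq_bigr do rewrite mxE mulr_suml.
rewrite exchange_big; apply: eq_bigr => j _ /=.
by rewrite dotE mulr_sumr; apply: eq_bigr => k _; rewrite mxE; ring.
Qed.

(** The weights sum to one, so the constant [dot u v] can be spread over the columns. *)
Lemma sum_simplex_dot A x u v : simplex x ->
  \sum_(j < n) x j 0 * dot (col j A - u) v = dot (A *m x - u) v.
Proof.
move=> [_ x1]; rewrite dotBl dot_mulmxl -[dot u v]mul1r -x1 mulr_suml -sumrB.
by apply: eq_bigr => j _; rewrite dotBl mulrBr.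
Qed.

Lemma simplex_delta (j : 'I_n) : simplex (delta_mx j 0 : 'cV[R]_n).
Proof.
split=> [k|]; first by rewrite mxE ler0n.
rewrite (bigD1 j) //= mxE !eqxx big1 ?addr0 // => k /negPf kj.
by rewrite mxE kj.
Qed.

Lemma simplex_conv x z (t : R) : simplex x -> simplex z -> 0 <= t <= 1 ->
  simplex (x + t *: (z - x)).
Proof.
move=> [x0 x1] [z0 z1] /andP[t0 t1]; split=> [k|].
  rewrite !mxE; have -> : x k 0 + t * (z k 0 - x k 0)
    = (1 - t) * x k 0 + t * z k 0 by ring.
  by rewrite addr_ge0 // mulr_ge0 // subr_ge0.
under eq_bigr do rewrite !mxE.
by rewrite big_split /= -mulr_sumr sumrB x1 z1 subrr mulr0 addr0.
Qed.

Lemma svm_objectiveE A x : svm_objective A x = 2^-1 * dot (A *m x) (A *m x).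
Proof. by rewrite /svm_objective /dot trmx_mul !mulmxA. Qed.

(** First-order optimality: if the derivative of the objective from [x] towards [z] were negative, a
    short step along that segment would lower the objective. *)
Lemma svm_optimal_variational A x z : svm_optimal A x -> simplex z ->
  0 <= dot (A *m z - A *m x) (A *m x).
Proof.
move=> [sx opt] sz; rewrite leNgt; apply/negP => lt0.
set v := A *m z - A *m x in lt0.
set p := - dot v (A *m x); set q := dot v v.
have p0 : 0 < p by rewrite oppr_gt0.
have q0 : 0 <= q by exact: dot_ge0.
have pq : 0 < p + q by lra.
(* A step small enough for the linear decrease to beat the quadratic term. *)
pose t := p / (p + q).
have t0 : 0 < t by rewrite divr_gt0.
have t1 : t <= 1 by rewrite ler_pdivrMr // mul1r lerDl.
have tq : t * q <= p.
  by rewrite /t mulrAC ler_pdivrMr // ler_pM2l // lerDr ltW.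
have tI : 0 <= t <= 1 by rewrite ltW.
have := opt _ (simplex_conv sx sz tI).
rewrite !svm_objectiveE mulmxDr -scalemxAr mulmxBr -/v.
rewrite dotDl 2!dotDr 2!dotZl 2!dotZr (dotC (A *m x) v) -/q.
have -> : dot v (A *m x) = - p by rewrite opprK.
(* The objective changes by [- t * p + t ^+ 2 * q / 2], which is at most [- t * p / 2] because
   [t * q <= p]. *)
by have := mulr_gt0 t0 p0; have := ler_wpM2l (ltW t0) tq; lra.
Qed.

Lemma svm_optimal_dist A x xstar (g : R) : svm_optimal A xstar -> simplex x ->
  (forall j, dot (A *m x - col j A) (A *m x) <= g) ->
  norm2 (A *m x - A *m xstar) <= Num.sqrt g.
Proof.
move=> opt sx gap; have [ss _] := opt; have [s0 s1] := ss.
rewrite norm2E ler_wsqrtr //.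
have var := svm_optimal_variational opt sx.
have: dot (A *m x - A *m xstar) (A *m x) <= g.
  (* Both sides become averages with the weights of [xstar], to be compared column by column. *)
  rewrite -opprB dotNl -sum_simplex_dot // -sumrN -[g]mul1r -s1 mulr_suml.
  by apply: ler_sum => j _; rewrite -mulrN -dotNl opprB ler_wpM2l.
by rewrite dotBr; lra.
Qed.

(** Complementary slackness: a zero sum of nonnegative terms has only zero terms, and here the other
    factor of term [i] is positive. *)
Lemma svm_optimal_complementary A x (i : 'I_n) : svm_optimal A x ->
  0 < dot (col i A - A *m x) (A *m x) -> x i 0 = 0.
Proof.
move=> opt pos; have [ss _] := opt; have [s0 _] := ss.
have := sum_simplex_dot A (A *m x) (A *m x) ss.
rewrite subrr -(scale0r (A *m x)) dotZl mul0r => /eqP.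
rewrite psumr_eq0 => [/allP/(_ i (mem_index_enum i))|j _].
  by rewrite /= mulf_eq0 (gt_eqF pos) orbF => /eqP.
(* Column [j] is the image of the vertex [delta_mx j 0], so the variational inequality applies to
   it. *)
rewrite mulr_ge0 // colE.
exact: svm_optimal_variational (simplex_delta j).
Qed.

End Simplex.

Theorem corollary8 (R : realType) (d n : nat)
    (abar : 'I_n -> 'cV[R]_d) (y : 'I_n -> R) (A : 'M[R]_(d, n))
    (hy : forall j : 'I_n, y j = 1 \/ y j = -1)
    (hA : forall j : 'I_n, col j A = y j *: abar j)
    (xstar : 'cV[R]_n) (hxstar : svm_optimal A xstar)
    (x : 'cV[R]_n) (hx : simplex x) (i : 'I_n) :
  dot (col i A - A *m x) (A *m x) >
    Num.sqrt (max_over i (fun j : 'I_n => dot (A *m x - col j A) (A *m x)))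
      * norm2 (col i A - A *m x) ->
  xstar i 0 = 0.
Proof.
set g := max_over _ _ => screen.
have gap j : dot (A *m x - col j A) (A *m x) <= g.
  exact: (le_bigmax _ (fun j => dot (A *m x - col j A) (A *m x)) j).
have dist := svm_optimal_dist hxstar hx gap.
apply: (svm_optimal_complementary hxstar).
have var := svm_optimal_variational hxstar hx.
have cs := CauchySchwarz_dot (col i A - A *m x) (A *m x - A *m xstar).
have := ler_wpM2l (sqrtr_ge0 _ : 0 <= norm2 (col i A - A *m x)) dist.
(* Once the inner products are expanded, [screen], [cs] and the scaled distance bound make
   [dot (col i A - A *m x) (A *m xstar)] positive; adding [var] replaces [A *m x] by
   [A *m xstar]. *)
move: screen var cs; rewrite [Num.sqrt g * _]mulrC dotBr !dotBl.
by lra.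
Qed.
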